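(* Let $G=(V,E)$ be a strongly connected regular graph (potentially with loops) on $n$ vertices, and consider a pull voter model with agnostic states on $G$ (either synchronous or asynchronous), in which every vertex chooses among its neighbours (including potentially itself) with equal probability. Let $D_0\neq\emptyset$ be the initial set of gnostic vertices, and let $T_a$ denote the number of rounds it takes for the agnostic vertices to disappear from the graph. Let $g(n)=\log(n)$ in the synchronous case and $g(n)=n\log(n)$ in the asynchronous case. Then, for every function $C(n)$, $$\mathbb{P}\big(T_a>C(n)\,n\,g(n)\big)\le 2n^{-C(n)/3+2},$$ and also $$\mathbb{E}[T_a]\le 6\,n\,g(n)+4 .$$
   Context: Graphs are in general directed, and an edge $(v,u)$ means that $v$ may select $u$; the neighbours among which $v$ chooses are its out-neighbours (an undirected graph is the case where every edge is present in both directions). Pull voter model with agnostic states: at each time each node is either agnostic (no colour) or gnostic (has a colour). In the synchronous version, at each round every node $v$ independently selects one of its out-neighbours $u$, here uniformly at random; if $u$ is agnostic, $v$ does not change its state, and if $u$ is gnostic, $v$ copies the colour of $u$ (and so is gnostic from then on). All updates in a round are simultaneous and use the states at the start of the round. In the asynchronous version, at each round a single node is chosen uniformly at random from $V$, and only that node selects an out-neighbour and updates by the same rule. Gnostic nodes never become agnostic again. *)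

(* Defs.v *)
(* MathComp / MathComp-Analysis. *)
From HB Require Import structures.
From mathcomp Require Import all_boot all_order all_algebra.
From mathcomp Require Import all_classical all_reals all_analysis.
Set Implicit Arguments.
Unset Strict Implicit.
Unset Printing Implicit Defensive.
Import Order.TTheory GRing.Theory Num.Theory.
Local Open Scope classical_set_scope.
Local Open Scope ring_scope.

(* A directed graph, possibly with loops, is a relation [e] on a finite type;
   [e v u] means that [v] may select [u]. *)
Definition out_nbrs (V : finType) (e : rel V) (v : V) : {set V} :=
  [set u | e v u].

Definition in_nbrs (V : finType) (e : rel V) (v : V) : {set V} :=
  [set u | e u v].

Definition strongly_connected (V : finType) (e : rel V) : Prop :=
  forall u v : V, connect e u v.

(* Regularity of a directed graph: all in- and out-degrees are equal. A loop
   counts once in each. *)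
Definition regular (V : finType) (e : rel V) : Prop :=
  exists k : nat, forall v : V, #|out_nbrs e v| = k /\ #|in_nbrs e v| = k.

(* [s v = None] when [v] is agnostic, [s v = Some c] when [v] is gnostic with
   colour [c]. *)
Definition gnostic (V : finType) (K : Type) (s : V -> option K) : {set V} :=
  [set v | isSome (s v)].

(* [m v = Some u] when [v] selects [u] in the current round, and [m v = None]
   when [v] is not activated in this round. *)
Definition pull_update (V K : Type) (m : V -> option V) (s : V -> option K) :
    V -> option K :=
  fun v => if m v is Some u then
             (if s u is Some c then Some c else s v)
           else s v.

Fixpoint pull_state (V K : Type) (m : nat -> V -> option V)
    (s0 : V -> option K) (t : nat) : V -> option K :=
  if t is t'.+1 then pull_update (m t') (pull_state m s0 t') else s0.

(* For random variables with values in a finite set [S], whose subsets are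
   all regarded as events. *)
Definition discrete_random_variable (d : measure_display)
    (Omega : measurableType d) (S : finType) (X : Omega -> S) : Prop :=
  forall x : S, measurable [set w | X w = x].

Definition mutually_independent (d : measure_display)
    (Omega : measurableType d) (R : realType) (P : probability Omega R)
    (I : eqType) (S : finType) (X : I -> Omega -> S) : Prop :=
  forall (J : seq I) (A : I -> set S), uniq J ->
    (P (\bigcap_(i in [set` J]) (X i @^-1` A i)) =
     \prod_(i <- J) P (X i @^-1` A i))%E.

Definition uniform_out (R : realType) (V : finType) (e : rel V) (v u : V) : R :=
  if e v u then #|out_nbrs e v|%:R^-1 else 0.

Definition synchronous_moves (d : measure_display) (Omega : measurableType d)
    (R : realType) (P : probability Omega R) (V : finType) (e : rel V)
    (m : Omega -> nat -> V -> option V) : Prop :=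
  exists sel : nat * V -> Omega -> V,
    [/\ forall i, discrete_random_variable (sel i),
        mutually_independent P sel,
        forall (t : nat) (v u : V),
          P [set w | sel (t, v) w = u] = (uniform_out R e v u)%:E &
        forall w t v, m w t v = Some (sel (t, v) w)].

(* [pick t w] is the pair formed by the node activated in round [t.+1] and the
   out-neighbour that it selects. *)
Definition asynchronous_moves (d : measure_display) (Omega : measurableType d)
    (R : realType) (P : probability Omega R) (V : finType) (e : rel V)
    (m : Omega -> nat -> V -> option V) : Prop :=
  exists pick : nat -> Omega -> V * V,
    [/\ forall t, discrete_random_variable (pick t),
        mutually_independent P pick,
        forall (t : nat) (v u : V),
          P [set w | pick t w = (v, u)] =
          (#|V|%:R^-1 * uniform_out R e v u)%:E &
        forall w t v,
          m w t v = if v == (pick t w).1 then Some (pick t w).2 else None].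

Variant schedule := Synchronous | Asynchronous.

Definition pull_moves (sched : schedule) (d : measure_display)
    (Omega : measurableType d) (R : realType) (P : probability Omega R)
    (V : finType) (e : rel V) (m : Omega -> nat -> V -> option V) : Prop :=
  match sched with
  | Synchronous => synchronous_moves P e m
  | Asynchronous => asynchronous_moves P e m
  end.

(* Equal to [+oo] when agnostic vertices never disappear. *)
Definition gnostic_time (R : realType) (V : finType) (K : Type)
    (m : nat -> V -> option V) (s0 : V -> option K) : \bar R :=
  ereal_inf [set t%:R%:E | t in
    [set t : nat | gnostic (pull_state m s0 t) = [set: V]%SET]].

Definition time_scale (R : realType) (sched : schedule) (n : nat) : R :=
  match sched with
  | Synchronous => ln n%:R
  | Asynchronous => n%:R * ln n%:R
  end.

(* Main.v *)
(* A vertex becomes gnostic as soon as it selects a gnostic out-neighbour, so the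
   gnostic set spreads along shortest paths to D_0. Let L_0 = D_0, ..., L_M be the
   distance layers and k the degree. As G is Eulerian, cuts are balanced, which
   gives k <= |L_(i-1)| + |L_i| + |L_(i+1)| (Soares) and hence (M + 1) k <= 3 n.
   Fix for every vertex outside D_0 a parent one layer below. If, for each i, every
   vertex of L_i selects its parent during the i-th block of N rounds, all vertices
   are gnostic at time M N; by independence and the union bound this fails with
   probability at most n (1 - 1/q)^N, where q = k (synchronous) or q = n k
   (asynchronous). Since M q ln n <= 3 n g(n), this gives the tail bound, and summing
   it over time, with the trivial bound 1 for the first q ln n blocks, gives the
   expectation. *)
Require Import Defs.
From HB Require Import structures.
From mathcomp Require Import all_boot all_order all_algebra.
From mathcomp Require Import all_classical all_reals all_analysis.
From mathcomp Require Import measurable_realfun zify ring lra.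
Set Implicit Arguments.
Unset Strict Implicit.
Unset Printing Implicit Defensive.
Import Order.TTheory GRing.Theory Num.Theory.
Local Open Scope classical_set_scope.
Local Open Scope ring_scope.

(** * Distance layers in a regular directed graph *)

Section Layers.
Local Open Scope nat_scope.
Variables (V : finType) (e : rel V) (k : nat) (f : V -> nat).
Hypothesis out_degree : forall v, \sum_u e v u = k.
Hypothesis in_degree : forall u, \sum_v e v u = k.
Hypothesis level_step : forall v u, e v u -> f v <= (f u).+1.

(** The out-degrees over [D] and the in-degrees over [D] both sum to [k] times the size of [D];
    cancelling the edges inside [D] leaves the two sides of the cut. *)
Lemma cut_balance (D : pred V) :
  \sum_(x | D x) \sum_(y | ~~ D y) e x y =
  \sum_(x | ~~ D x) \sum_(y | D y) e x y.
Proof.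
have outD : \sum_(x | D x) \sum_y (e x y : nat) = \sum_(x | D x) k.
  by apply: eq_bigr.
have inD : \sum_(y | D y) \sum_x (e x y : nat) = \sum_(y | D y) k.
  by apply: eq_bigr.
have : \sum_(x | D x) \sum_(y | D y) (e x y : nat) +
       \sum_(x | D x) \sum_(y | ~~ D y) (e x y : nat) =
       \sum_(x | D x) \sum_(y | D y) (e x y : nat) +
       \sum_(x | ~~ D x) \sum_(y | D y) (e x y : nat).
  rewrite -big_split /= [in RHS]exchange_big /=.
  rewrite [X in _ = _ + X]exchange_big /= -big_split /=.
  transitivity (\sum_(x | D x) \sum_y (e x y : nat)).
    by apply: eq_bigr => x _; rewrite [RHS](bigID D).
  rewrite outD -inD.
  by apply: eq_bigr => x _; rewrite [LHS](bigID D).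
by move/addnI.
Qed.

(* With [i = f v]: edges leaving layer [i] end in layers [i - 1], [i], or above [i]. By
   [cut_balance] there are as many of the last kind as edges entering
   [f <= i] from outside, and these all run from layer [i + 1] to layer [i]. *)
Lemma degree_le_layers (v : V) :
  k <= \sum_u ((f u).+1 == f v) + \sum_u (f u == f v) +
       \sum_u (f u == (f v).+1).
Proof.
set i := f v.
have Li_gt0 : 0 < \sum_u (f u == i) by rewrite (bigD1 v) //= eqxx.
have below x y : f x = i -> (e x y : nat) <=
    ((f y).+1 == i) + (f y == i) + e x y * (i < f y).
  by move=> fx; case exy: (e x y) => //; have := level_step exy; lia.
have up : \sum_(x | f x == i) \sum_y e x y * (i < f y) <=
    (\sum_u (f u == i.+1)) * \sum_u (f u == i).
  apply: (@leq_trans (\sum_(x | f x <= i) \sum_(y | ~~ (f y <= i)) e x y)).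
    apply: (@leq_trans (\sum_(x | f x == i) \sum_(y | ~~ (f y <= i)) e x y)).
      apply: eq_leq; apply: eq_bigr => x _; rewrite [RHS]big_mkcond /=.
      by apply: eq_bigr => y _; rewrite -ltnNge; case: ltnP; rewrite ?muln1 ?muln0.
    rewrite big_mkcond [leqRHS]big_mkcond /=; apply: leq_sum => x _.
    by case: eqP => // ->; rewrite leqnn.
  rewrite cut_balance big_distrl /= big_mkcond /=; apply: leq_sum => x _.
  case: (leqP (f x) i) => //= fx; rewrite big_distrr big_mkcond /=.
  apply: leq_sum => y _; case: (leqP (f y) i) => //= fy.
  by case exy: (e x y) => //; have := level_step exy; lia.
have sum_layer (F : V -> nat) :
    \sum_(x | f x == i) F x = \sum_x (f x == i) * F x.
  by rewrite big_mkcond; apply: eq_bigr => x _; case: eqP; rewrite ?mul1n.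
(* Multiplying the claim by the size of layer [i] turns the left side into the number of edges
   leaving that layer, to which [below] and [up] apply. *)
rewrite -(leq_pmul2r Li_gt0) [X in X <= _](_ : _ =
    \sum_(x | f x == i) \sum_y (e x y : nat)); last first.
  rewrite (eq_bigr _ (fun x _ => out_degree x)) sum_layer mulnC.
  by rewrite big_distrl.
rewrite mulnDl; apply: leq_trans (leq_add (leqnn _) up).
rewrite -big_split /= mulnC big_distrl /= -sum_layer -big_split.
apply: leq_sum => x /eqP fx.
by rewrite -big_split; apply: leq_sum => y _; exact: below.
Qed.

Variable M : nat.
Hypothesis layer_neq0 : forall i, i <= M -> exists v, f v = i.

Lemma sum_eq_le1 (j : nat) m : \sum_(i < m) (j == i) <= 1.
Proof.
case: (ltnP j m) => jm; last by rewrite big1 // => i _; have := ltn_ord i; lia.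
rewrite (bigD1 (Ordinal jm)) //= eqxx big1 // => i /eqP ij.
by apply/eqP; rewrite eqb0; apply: contra_notN ij => /eqP ij; apply: val_inj.
Qed.

Lemma layer_count_le_order : M < #|V|.
Proof.
have : \sum_(i < M.+1) 1 <= \sum_(i < M.+1) \sum_v (f v == i).
  apply: leq_sum => i _; have [v fv] := layer_neq0 (ltn_ord i).
  by rewrite (bigD1 v) //= fv eqxx.
rewrite sum_nat_const card_ord muln1 exchange_big /= => /leq_trans; apply.
rewrite -sum1_card; apply: leq_sum => v _; exact: sum_eq_le1.
Qed.

(** Sum [degree_le_layers] over the layers: each vertex is counted at most three times, once for its
    own layer and once for each adjacent one. *)
Lemma layer_count_degree : M.+1 * k <= 3 * #|V|.
Proof.
have : \sum_(i < M.+1) k <= \sum_(i < M.+1) \sum_v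
   (((f v).+1 == i) + (f v == i) + (f v == i.+1)).
  apply: leq_sum => i _; have [v <-] := layer_neq0 (ltn_ord i).
  by rewrite !big_split /=; exact: degree_le_layers.
rewrite sum_nat_const card_ord exchange_big /= => /leq_trans; apply.
rewrite mulnC -sum_nat_const; apply: leq_sum => v _.
rewrite !big_split /= -[3]/(1 + 1 + 1) !leq_add ?sum_eq_le1 //.
case: (f v) => [|j]; first by rewrite big1.
under eq_bigr do rewrite eqSS; exact: sum_eq_le1.
Qed.

End Layers.

(** * Distance to the initial gnostic set *)

Section Distance.
Local Open Scope nat_scope.
Variables (V : finType) (e : rel V) (D : {set V}).

(** [f v] is the length of a shortest path from [v] to [D], finite by strong connectivity.
    Prepending an edge gives the upper bound, and the first edge of a shortest path gives the
    descent. *)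
Lemma level_exists : strongly_connected e -> D != finset.set0 ->
  exists f : V -> nat, [/\ forall v, (f v == 0) = (v \in D),
    forall v u, e v u -> f v <= (f u).+1 &
    forall v, 0 < f v -> exists2 u, e v u & f v = (f u).+1].
Proof.
move=> conn /finset.set0Pn[x0 Dx0].
pose reach n v := `[< exists p, [/\ path e v p, last v p \in D & size p = n] >].
have reach_ex v : exists n, reach n v.
  have /connectP[p pp lp] := conn v x0.
  by exists (size p); apply/asboolP; exists p; rewrite -lp.
pose f v := ex_minn (reach_ex v).
have fP v : exists p, [/\ path e v p, last v p \in D & size p = f v].
  by rewrite /f; case: ex_minnP => n /asboolP.
have fle v p : path e v p -> last v p \in D -> f v <= size p.
  move=> pp lp; rewrite /f; case: ex_minnP => n _; apply.
  by apply/asboolP; exists p.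
have fstep v u : e v u -> f v <= (f u).+1.
  move=> evu; have [p [pp lp <-]] := fP u.
  by apply: (fle v (u :: p)) => //=; rewrite evu.
exists f; split=> // v.
  have [p [pp lp sp]] := fP v; apply/eqP/idP => [fv0|Dv].
    by move: sp lp; rewrite fv0 => /size0nil ->.
  by apply/eqP; rewrite -leqn0; exact: (fle v [::]).
have [[|u p] [/= pp lp sp]] := fP v; first by rewrite -sp.
move: pp => /andP[evu pp] _; exists u => //.
by apply/eqP; rewrite eqn_leq fstep //= -sp ltnS fle.
Qed.

Lemma level_downward (f : V -> nat) :
  (forall v, 0 < f v -> exists2 u, e v u & f v = (f u).+1) ->
  forall v i, i <= f v -> exists u, f u = i.
Proof.
move=> fdown v i; move: {2}(f v) (erefl (f v)) => m; elim: m v => [|m IH] v fv.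
  by rewrite fv leqn0 => /eqP ->; exists v.
rewrite fv leq_eqVlt => /predU1P[->|]; first by exists v.
have [|u _] := fdown v; first by rewrite fv.
by rewrite fv ltnS => -[fu]; rewrite fu => /(IH _ (esym fu)).
Qed.

End Distance.

(** * Spread of the gnostic set for fixed moves, and its completion time *)

Definition all_gnostic (V : finType) (K : Type) (m : nat -> V -> option V)
    (s0 : V -> option K) (t : nat) : bool :=
  [forall v, isSome (pull_state m s0 t v)].

Section GnosticTime.
Variables (V : finType) (K : Type) (m : nat -> V -> option V).
Variable s0 : V -> option K.
Local Notation state := (pull_state m s0).

Lemma isSome_pull_stateS t v : isSome (state t.+1 v) =
  isSome (state t v) || (if m t v is Some u then isSome (state t u) else false).
Proof.
rewrite /= /pull_update; case: (m t v) => [u|]; last by rewrite orbF.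
by case: (state t u) => [c|] /=; rewrite ?orbT ?orbF.
Qed.

Lemma isSome_pull_state_mono t t' v : (t <= t')%N ->
  isSome (state t v) -> isSome (state t' v).
Proof.
move=> /subnKC <-; elim: (t' - t)%N => [|j IH] sv; first by rewrite addn0.
by rewrite addnS isSome_pull_stateS IH.
Qed.

Lemma all_gnostic_mono t t' : (t <= t')%N ->
  all_gnostic m s0 t -> all_gnostic m s0 t'.
Proof.
by move=> tt' /forallP st; apply/forallP => v; exact: isSome_pull_state_mono (st v).
Qed.

Lemma all_gnosticP t :
  gnostic (state t) = [set: V]%SET <-> all_gnostic m s0 t.
Proof.
split=> [/setP st|/forallP st]; last by apply/setP => v; rewrite !inE st.
by apply/forallP => v; have := st v; rewrite !inE.
Qed.

(* The vertices at distance [i] from the source get the [i]-th block of [N]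
   rounds to select their parent. *)
Lemma isSome_pull_state_phase (f : V -> nat) (parent : V -> V) (N : nat) :
  (forall v, f v = 0%N -> isSome (s0 v)) ->
  (forall v, (0 < f v)%N -> f v = (f (parent v)).+1) ->
  (forall v, (0 < f v)%N -> exists2 t,
    ((f v).-1 * N <= t < (f v).-1 * N + N)%N & m t v = Some (parent v)) ->
  forall v, isSome (state (f v * N) v).
Proof.
move=> f0 fS hit v; move: {2}(f v) (erefl (f v)) => i.
elim: i v => [|i IH] v fv; first by rewrite fv f0.
have fv0 : (0 < f v)%N by rewrite fv.
have [t /andP[lt ut] mt] := hit v fv0.
have fp : f (parent v) = i by have := fS v fv0; rewrite fv => -[].
apply: (@isSome_pull_state_mono t.+1).
  by rewrite fv mulSn; move: ut; rewrite fv /=; lia.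
rewrite isSome_pull_stateS mt; apply/orP; right.
by apply: isSome_pull_state_mono (IH _ fp); rewrite fp; move: lt; rewrite fv.
Qed.

Variable R : realType.
Local Notation Ta := (gnostic_time R m s0).

Lemma gnostic_time_le t : all_gnostic m s0 t -> (Ta <= t%:R%:E)%E.
Proof.
by move=> gt; apply: ereal_inf_lbound; exists t => //; apply/all_gnosticP.
Qed.

Lemma gnostic_time_ge t : ~~ all_gnostic m s0 t -> (t.+1%:R%:E <= Ta)%E.
Proof.
move=> gt; apply/ereal_infP => _ [j /all_gnosticP gj <-].
rewrite lee_fin ler_nat ltnNge; apply: contra gt => jt.
exact: all_gnostic_mono gj.
Qed.

Lemma gnostic_time_ge0 : (0 <= Ta)%E.
Proof. by apply/ereal_infP => _ [j _ <-]; rewrite lee_fin. Qed.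

(** The time is an integer or infinite, so exceeding [c] amounts to exceeding its integer part. *)
Lemma gnostic_time_gt (c : R) : 0 <= c ->
  (c%:E < Ta)%E = ~~ all_gnostic m s0 (Num.truncn c).
Proof.
move=> /truncn_itv /andP[tc ct]; apply/idP/idP => [|/gnostic_time_ge]; last first.
  by apply: lt_le_trans; rewrite lte_fin.
apply: contraTN => /gnostic_time_le Tc; rewrite -leNgt.
by rewrite (le_trans Tc) // lee_fin.
Qed.

(** Pointwise tail-sum formula: by monotonicity the terms are 1 before the completion time and 0
    from then on. If agnostic vertices persist, both sides are infinite. *)
Lemma gnostic_time_series :
  Ta = (\sum_(0 <= t <oo) (~~ all_gnostic m s0 t)%:R%:E)%E.
Proof.
have term_ge0 (t : nat) : (0 <= (~~ all_gnostic m s0 t)%:R%:E :> \bar R)%E.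
  by rewrite lee_fin.
have prefix T : (forall t, (t < T)%N -> ~~ all_gnostic m s0 t) ->
    (\sum_(0 <= t < T) (~~ all_gnostic m s0 t)%:R%:E = T%:R%:E :> \bar R)%E.
  move=> nT; rewrite sumEFin; congr (_%:E).
  rewrite (eq_big_nat _ _ (F2 := fun=> 1%:R)); last first.
    by move=> t /nT ->.
  by rewrite sumr_const_nat subn0.
have [[T gT]|never] := pselect (exists T, all_gnostic m s0 T).
  pose T0 := ex_minn (ex_intro _ T gT : exists T, all_gnostic m s0 T).
  have [gT0 minT0] : all_gnostic m s0 T0 /\
      forall t, (t < T0)%N -> ~~ all_gnostic m s0 t.
    rewrite /T0; case: ex_minnP => T1 g1 min1; split=> // t.
    by rewrite ltnNge; apply: contra => /min1.
  rewrite (nneseries_split 0 T0)// add0n (prefix _ minT0) eseries0 ?adde0.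
    apply/eqP; rewrite eq_le gnostic_time_le //=.
    apply/ereal_infP => _ [j /all_gnosticP gj <-].
    rewrite lee_fin ler_nat leqNgt; apply/negP => /minT0.
    by rewrite gj.
  by move=> t T0t _; rewrite (all_gnostic_mono T0t gT0).
have nevert t : ~~ all_gnostic m s0 t by apply/negP => gt; apply: never; exists t.
rewrite (_ : Ta = +oo%E); last first.
  rewrite /gnostic_time (_ : [set t | _] = set0) ?image_set0 ?ereal_inf0 //.
  by rewrite -subset0 => t /all_gnosticP; apply/negP.
apply/esym/eqyP => r r0.
apply: le_trans (nneseries_lim_ge (Num.truncn r).+1 _) => //.
rewrite prefix // lee_fin.
by have /andP[_ /ltW] := truncn_itv (ltW r0).
Qed.

End GnosticTime.

(* [selection_period sched n k] is the expected waiting time, in rounds, until a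
   given vertex of out-degree [k] selects a given out-neighbour. *)
Definition selection_period (sched : schedule) (n k : nat) : nat :=
  match sched with Synchronous => k | Asynchronous => (n * k)%N end.

(** * Real estimates for the miss probability *)

Section Estimates.
Variable R : realType.
Implicit Types (n k M N q : nat).

Lemma expR_half_le2 : expR (2^-1 : R) <= 2.
Proof.
have := expR_ge1Dx (- 2^-1 : R); rewrite expRN => h.
have e0 := expR_gt0 (2^-1 : R).
have : expR (2^-1 : R) * (1 + - 2^-1) <= 1.
  by rewrite -[leRHS](divff (lt0r_neq0 e0)) ler_pM2l.
lra.
Qed.

Lemma miss_prob_ge0 q : 0 <= 1 - q%:R^-1 :> R.
Proof.
rewrite subr_ge0; case: q => [|q]; first by rewrite invr0.
by rewrite invf_le1 ?ltr0n // ler1n.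
Qed.

Lemma miss_prob_expr_le q N : (1 - q%:R^-1) ^+ N <= expR (- (N%:R / q%:R)) :> R.
Proof.
rewrite -mulrN expRM_natl lerXn2r ?nnegrE ?miss_prob_ge0 ?expR_ge0 //.
exact: expR_ge1Dx.
Qed.

(** Here [x] stands for n g(n). Rounding to whole blocks costs a factor at most e, bounded by 4, and
    [4 n <= 2 n^2] since [n >= 2]. *)
Lemma miss_prob_tail n M q (C x : R) : (1 < n)%N -> (0 < M)%N -> (0 < q)%N ->
  0 <= C -> (M * q)%:R * ln n%:R <= 3 * x ->
  n%:R * (1 - q%:R^-1) ^+ (Num.truncn (C * x) %/ M) <=
  2 * n%:R `^ (- (C / 3) + 2) :> R.
Proof.
move=> n1 M0 q0 C0 Mqx.
set t := Num.truncn _; set N := (t %/ M)%N.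
have nR : 2 <= n%:R :> R by rewrite ler_nat.
have n0 : 0 < n%:R :> R by lra.
have q0R : 1 <= q%:R :> R by rewrite ler1n.
have M0R : 0 < M%:R :> R by rewrite ltr0n.
have qV : q%:R^-1 <= 1 :> R by rewrite invf_le1 //; lra.
have ln0 : 0 <= ln (n%:R : R) by apply: ln_ge0; lra.
have x0 : 0 <= C * x.
  rewrite mulr_ge0 //; have := mulr_ge0 (ler0n R (M * q)) ln0; lra.
have tN : C * x <= M%:R * N.+1%:R.
  have /andP[_ /ltW tx] := truncn_itv x0; apply: (le_trans tx).
  by rewrite -natrM ler_nat /N mulnC; exact: ltn_ceil.
have rate : C / 3 * ln n%:R <= N.+1%:R / q%:R.
  rewrite ler_pdivlMr; last lra.
  rewrite -(ler_pM2l M0R); apply: le_trans tN.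
  have : C * ((M * q)%:R * ln n%:R) <= C * (3 * x) by rewrite ler_wpM2l.
  by rewrite natrM; lra.
have step : (1 - q%:R^-1) ^+ N <= 4 * n%:R `^ (- (C / 3)).
  apply: (le_trans (miss_prob_expr_le _ _)).
  rewrite /powR gt_eqF // -[4]/(2 * 2)%:R natrM.
  (* Passing from [N.+1] in [rate] to [N] adds [1/q <= 1] to the exponent, split into two halves so
     that [expR_half_le2] applies twice. *)
  apply: (@le_trans _ _ (expR (2^-1 + 2^-1 + - (C / 3) * ln n%:R))).
    rewrite ler_expR; move: rate; rewrite -[N.+1%:R]natr1 mulrDl mul1r; lra.
  rewrite !expRD ler_wpM2r ?expR_ge0 //.
  by apply: ler_pM; rewrite ?expR_ge0 ?expR_half_le2.
rewrite powRD ?(gt_eqF n0) ?implybT // powR_mulrn ?ler0n //.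
have p0 := powR_ge0 (n%:R : R) (- (C / 3)).
apply: (@le_trans _ _ (n%:R * (4 * n%:R `^ (- (C / 3))))).
  by rewrite ler_pM2l.
rewrite [leRHS](_ : _ = n%:R * (2 * n%:R * n%:R `^ (- (C / 3)))); last ring.
by rewrite ler_pM2l // ler_wpM2r //; lra.
Qed.

Lemma sum_block_le M (a b : nat -> R) T : (0 < M)%N ->
  (forall t, 0 <= a t) -> (forall t, a t <= b (t %/ M)%N) ->
  \sum_(0 <= t < T) a t <= M%:R * \sum_(0 <= j < T) b j.
Proof.
(* Lengthening the sum to [T] full blocks is harmless because the terms are nonnegative. *)
move=> M0 a0 ab; apply: (@le_trans _ _ (\sum_(0 <= t < M * T) a t)).
  rewrite [leRHS](big_cat_nat (n := T)) //= ?leq_pmull //.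
  by rewrite lerDl sumr_ge0.
elim: T => [|T IH]; first by rewrite muln0 !big_geq // mulr0.
rewrite big_nat_recr //= mulrDr mulnS.
rewrite (big_cat_nat (n := (M * T)%N)) //= ?leq_addl // lerD //.
rewrite mulr_natl -[M in leRHS](addnK (M * T)%N) -sumr_const_nat.
apply: ler_sum_nat => t /andP[t1 t2]; apply: (le_trans (ab t)).
suff -> : (t %/ M = T)%N by [].
by apply/eqP; rewrite eqn_leq -ltnS ltn_divLR // leq_divRL // mulSn (mulnC T) t1 t2.
Qed.

(* The induction uses the invariant bound [N + q (1 - n r^J)], whose increments
   are exactly [n r^J] because [q (1 - r) = 1]. *)
Lemma sum_min_geometric_le n q N T : (0 < q)%N ->
  n%:R * (1 - q%:R^-1) ^+ N <= 1 :> R ->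
  \sum_(0 <= j < T) Num.min 1 (n%:R * (1 - q%:R^-1) ^+ j) <= N%:R + q%:R :> R.
Proof.
move=> q0 nN; set r := 1 - q%:R^-1; set b := fun j => Num.min 1 (n%:R * r ^+ j).
have r0 j : 0 <= n%:R * r ^+ j by rewrite mulr_ge0 // exprn_ge0 // miss_prob_ge0.
have b0 j : 0 <= b j by rewrite le_min ler01 r0.
have q1 : q%:R * (1 - r) = 1 by rewrite /r subKr divff // pnatr_eq0 -lt0n.
(* With [N + T] terms the induction starts at [N], where [n r^N <= 1] makes the invariant hold. *)
apply: (@le_trans _ _ (\sum_(0 <= j < N + T) b j)).
  rewrite [leRHS](big_cat_nat (n := T)) //= ?leq_addl //.
  by rewrite lerDl sumr_ge0.
apply: (@le_trans _ _ (N%:R + q%:R * (1 - n%:R * r ^+ (N + T)))); last first.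
  rewrite lerD2l; have := mulr_ge0 (ler0n R q) (r0 (N + T)%N); lra.
elim: T => [|T IH].
  rewrite addn0; apply: (@le_trans _ _ N%:R).
    rewrite -[leRHS]mulr1 mulr_natl -[N in leRHS]subn0 -sumr_const_nat.
    by apply: ler_sum_nat => j _; rewrite ge_min lexx.
  by rewrite lerDl mulr_ge0 // subr_ge0.
rewrite addnS big_nat_recr //= exprS.
have : b (N + T)%N <= n%:R * r ^+ (N + T) * (q%:R * (1 - r)).
  by rewrite q1 mulr1 ge_min lexx orbT.
lra.
Qed.

(* Tangent to [x ln x] at [x = sqrt e], with [sqrt e <= 2]. *)
Lemma mulr_ln_ge n : (0 < n)%N -> n%:R * 3 / 2 - 2 <= n%:R * ln n%:R :> R.
Proof.
move=> n0; have n0R : 0 < n%:R :> R by rewrite ltr0n.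
have := expR_ge1Dx (2^-1 - ln n%:R : R).
rewrite expRD expRN lnK ?posrE // => h.
have : n%:R * (1 + (2^-1 - ln n%:R)) <= expR 2^-1 :> R.
  by rewrite mulrC -ler_pdivlMr.
have := expR_half_le2; lra.
Qed.

Lemma selection_period_ln sched n k M : (M.+1 * k <= 3 * n)%N ->
  (M * selection_period sched n k)%:R * ln n%:R <=
  3 * (n%:R * time_scale R sched n) :> R.
Proof.
move=> Mk; have ln0 : 0 <= ln (n%:R : R).
  by case: n {Mk} => [|n]; [rewrite ln0|rewrite ln_ge0 // ler1n].
have MkR : M%:R * k%:R <= 3 * n%:R :> R.
  by rewrite -!natrM ler_nat; apply: leq_trans Mk; rewrite leq_mul2r leqnSn orbT.
case: sched => /=; rewrite !natrM; first by rewrite mulrA ler_wpM2r.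
rewrite -[leLHS]mulrA [leLHS](_ : _ = M%:R * k%:R * (n%:R * ln n%:R)); last ring.
by rewrite [leRHS]mulrA ler_wpM2r // mulr_ge0.
Qed.

(** In the expectation bound, [M] pays for rounding the block length up and [M q] for the geometric
    tail. For [k >= 2] the layer bound gives [M k <= 3 n - 2] and [M <= M k / 2]; for [k = 1] it is
    too weak and [M < n] replaces it. *)
Lemma selection_period_overhead sched n k M :
  (1 < n)%N -> (0 < k)%N -> (M < n)%N -> (M.+1 * k <= 3 * n)%N ->
  M%:R + (M * selection_period sched n k)%:R <=
  3 * (n%:R * time_scale R sched n) + 4 :> R.
Proof.
move=> n1 k0 Mn Mk; have := mulr_ln_ge (ltnW n1).
set l := n%:R * ln _ => lge.
have nR : 2 <= n%:R :> R by rewrite ler_nat.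
have MnR : M%:R + 1 <= n%:R :> R by rewrite natr1 ler_nat.
have MkR : (M%:R + 1) * k%:R <= 3 * n%:R :> R by rewrite natr1 -!natrM ler_nat.
have M0 : 0 <= M%:R :> R by [].
case: (leqP k 1) => k1.
  have -> : k = 1%N by apply/eqP; rewrite eqn_leq k1.
  case: sched => /=; rewrite !muln1 ?natrM -/l.
    by lra.
  rewrite (_ : 3 * (n%:R * l) = n%:R * (3 * l)); last ring.
  have : n%:R * (n%:R * (9/2) - 6) <= n%:R * (3 * l) by rewrite ler_wpM2l //; lra.
  have : M%:R * n%:R <= (n%:R - 1) * n%:R :> R by rewrite ler_wpM2r //; lra.
  have : 0 <= (n%:R - 2) * (n%:R - 2) :> R by rewrite -expr2 sqr_ge0.
  lra.
have kR : 2 <= k%:R :> R by rewrite ler_nat.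
have Mk2 : M%:R * 2 <= M%:R * k%:R :> R by rewrite ler_wpM2l.
case: sched => /=; rewrite !natrM -/l; first by lra.
rewrite (_ : 3 * (n%:R * l) = n%:R * (3 * l)); last ring.
have : n%:R * (n%:R * (9/2) - 6) <= n%:R * (3 * l) by rewrite ler_wpM2l //; lra.
have : n%:R * (M%:R * k%:R) <= n%:R * (3 * n%:R - 2) :> R.
  by rewrite ler_wpM2l //; lra.
(* This product is twice the gap left between the two sides after the preceding estimates. *)
have : 0 <= (n%:R - 2) * (n%:R * 3 - 5) :> R by rewrite mulr_ge0; lra.
lra.
Qed.

End Estimates.

(** * Probability and measurability of the random moves *)

Lemma independent_miss (d : measure_display) (Omega : measurableType d)
    (R : realType) (P : probability Omega R) (I : eqType) (S : finType)
    (X : I -> Omega -> S) (J : seq I) (x : S) (q : R) :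
  (forall i, Defs.discrete_random_variable (X i)) ->
  mutually_independent P X -> uniq J ->
  (forall i, i \in J -> P [set w | X i w = x] = q%:E) ->
  P (\bigcap_(i in [set` J]) [set w | X i w <> x]) =
    ((1 - q) ^+ size J)%:E.
Proof.
move=> mX indep uJ PX; rewrite (indep J (fun=> [set y | y <> x]) uJ).
rewrite (eq_big_seq (fun=> (1 - q)%:E)) => [|i iJ].
  by rewrite prodEFin big_const_seq count_predT iter_mulr_1.
have -> : X i @^-1` [set y | y <> x] = ~` [set w | X i w = x] by [].
rewrite probability_setC ?PX //; exact: mX.
Qed.

Section Moves.
Variables (d : measure_display) (Omega : measurableType d) (R : realType).
Variables (P : probability Omega R) (V : finType) (e : rel V).
Variables (sched : schedule) (m : Omega -> nat -> V -> option V).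
Hypothesis moves : pull_moves sched P e m.

Lemma measurable_pull_moves t v u : measurable [set w | m w t v = Some u].
Proof.
case: sched moves => [[sel [msel _ _ mE]]|[pick [mpick _ _ mE]]].
  have -> : [set w | m w t v = Some u] = [set w | sel (t, v) w = u].
    by apply/seteqP; split=> w; rewrite /= mE; [move=> []|move=> ->].
  exact: msel.
have -> : [set w | m w t v = Some u] = [set w | pick t w = (v, u)].
  apply/seteqP; split=> w; rewrite /= mE; last by move=> ->; rewrite eqxx.
  by case: eqP => // -> [<-]; rewrite -surjective_pairing.
exact: mpick.
Qed.

(** Under either schedule a round realises the selection of [u] by [v] with probability [1/q],
    independently between rounds. The synchronous case restricts the family indexed by [(t, v)] to
    one vertex; the asynchronous case avoids the value [(v, u)]. *)
Lemma probability_miss v u a N : e v u ->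
  P (\bigcap_(t in [set` iota a N]) [set w | m w t v <> Some u]) =
  ((1 - (selection_period sched #|V| #|out_nbrs e v|)%:R^-1) ^+ N)%:E.
Proof.
move=> evu; case: sched moves => [[sel [msel indep PE mE]]|[pick [mpick indep PE mE]]].
  pose J := [seq (t, v) | t <- iota a N].
  have uJ : uniq J by rewrite map_inj_uniq ?iota_uniq // => t t' [].
  rewrite -[X in (_ ^+ X)%:E](size_iota a) -(size_map (fun t => (t, v))).
  rewrite -(independent_miss (x := u) msel indep uJ); last first.
    by move=> _ /mapP[t _ ->]; rewrite PE /uniform_out evu.
  congr (P _); apply/seteqP; split=> w /= h.
    by move=> _ /= /mapP[t /h + ->]; rewrite /= mE => + selu; apply; rewrite selu.
  move=> t ta /=; rewrite mE => -[]; apply: (h (t, v)) => /=.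
  exact: map_f.
rewrite -[X in (_ ^+ X)%:E](size_iota a).
rewrite -(independent_miss (x := (v, u)) mpick indep (iota_uniq a N)); last first.
  by move=> t _; rewrite PE /uniform_out evu natrM invfM.
congr (P _); apply/seteqP; split=> w /= h t /h /=; rewrite mE.
  by move=> + pt; rewrite pt eqxx.
by move=> np; case: eqP => // vE [uE]; apply: np; rewrite vE -uE -surjective_pairing.
Qed.

Variables (K : Type) (s0 : V -> option K).

(** Only gnosticism is followed, so the colour type [K] needs no measurable structure; one round
    adds a finite union over the vertex selected. *)
Lemma measurable_all_gnostic t :
  measurable [set w | all_gnostic (m w) s0 t].
Proof.
have mstate v : measurable [set w | isSome (pull_state (m w) s0 t v)].
  elim: t v => [|t IH] v /=.
    case: (isSome (s0 v)).
      have -> : [set w : Omega | true] = setT by apply/seteqP; split.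
      exact: measurableT.
    have -> : [set w : Omega | false] = set0 by apply/seteqP; split.
    exact: measurable0.
  rewrite [X in measurable X](_ : _ =
      [set w | isSome (pull_state (m w) s0 t v)] `|`
      \bigcup_(u in [set: V]) ([set w | m w t v = Some u] `&`
        [set w | isSome (pull_state (m w) s0 t u)])).
    apply: measurableU => //; apply: fin_bigcup_measurable => [|u _].
      exact: finite_finset.
    by apply: measurableI => //; exact: measurable_pull_moves.
  apply/seteqP; split=> w; rewrite /= -/(pull_state (m w) s0 t.+1 v) isSome_pull_stateS.
    move=> /orP[|]; first by left.
    by case E: (m w t v) => [u|] // su; right; exists u.
  by move=> [->//|[u _ [/= -> ->]]]; rewrite orbT.
rewrite [X in measurable X](_ : _ =
    \bigcap_(v in [set: V]) [set w | isSome (pull_state (m w) s0 t v)]).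
  by apply: fin_bigcap_measurable => // v _; exact: mstate.
apply/seteqP; split=> w /=; first by move=> /forallP h v _; exact: h.
by move=> h; apply/forallP => v; exact: h.
Qed.

Lemma measurable_not_all_gnostic t :
  measurable [set w | ~~ all_gnostic (m w) s0 t].
Proof.
have -> : [set w | ~~ all_gnostic (m w) s0 t] =
    ~` [set w | all_gnostic (m w) s0 t].
  by apply/seteqP; split=> w /=; [move/negP|move=> /negP].
by apply: measurableC; exact: measurable_all_gnostic.
Qed.

Lemma measurable_gnostic_time_gt (c : R) :
  measurable [set w | (c%:E < gnostic_time R (m w) s0)%E].
Proof.
case: (lerP 0 c) => c0.
  under eq_set do rewrite gnostic_time_gt //.
  exact: measurable_not_all_gnostic.
rewrite (_ : [set w | _] = setT); first exact: measurableT.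
apply/seteqP; split=> w //= _.
by apply: lt_le_trans (gnostic_time_ge0 _ _ _); rewrite lte_fin.
Qed.

(** The tail-sum formula, integrated term by term thanks to nonnegativity. *)
Lemma expectation_gnostic_time :
  (\int[P]_w gnostic_time R (m w) s0 =
   \sum_(0 <= t <oo) P [set w | ~~ all_gnostic (m w) s0 t])%E.
Proof.
under eq_integral do rewrite gnostic_time_series.
rewrite integral_nneseries //=; last first.
  move=> t; apply/measurable_EFinP.
  rewrite (_ : (fun w => _) = \1_[set w | ~~ all_gnostic (m w) s0 t]).
    exact/measurable_indic/measurable_not_all_gnostic.
  by apply/funext => w; rewrite indicE mem_setE.
apply: eq_eseriesr => t _.
set A := [set w | ~~ all_gnostic (m w) s0 t].
have mA : measurable A by exact: measurable_not_all_gnostic.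
transitivity (\int[P]_w (\1_A w)%:E)%E; last by rewrite integral_indic // setIT.
by apply: eq_integral => w _; rewrite indicE mem_setE.
Qed.

Lemma measure_bigU_le (I : Type) (s : seq I) (F : I -> set Omega) :
  (forall i, measurable (F i)) ->
  (P (\big[setU/set0]_(i <- s) F i) <= \sum_(i <- s) P (F i))%E.
Proof.
move=> mF; elim: s => [|i s IH]; first by rewrite !big_nil measure0.
rewrite !big_cons (le_trans (measureU2 _ _ _)) ?leeD2l //.
exact: bigsetU_measurable.
Qed.

(** Union bound over the events that [v] misses its parent throughout its own block; outside all of
    them [isSome_pull_state_phase] makes every vertex gnostic by time [M * N]. *)
Lemma probability_not_all_gnostic (k M : nat) (f : V -> nat) N :
  (forall v, #|out_nbrs e v| = k) ->
  (forall v, f v = 0%N -> isSome (s0 v)) ->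
  (forall v, (0 < f v)%N -> exists2 u, e v u & f v = (f u).+1) ->
  (forall v, (f v <= M)%N) ->
  (P [set w | ~~ all_gnostic (m w) s0 (M * N)] <=
   (#|V|%:R * (1 - (selection_period sched #|V| k)%:R^-1) ^+ N)%:E)%E.
Proof.
move=> outk f0 fS fM.
(* At level 0 there is no parent; the default [v] is harmless because [bad v] is then empty. *)
pose parent v := if pselect (exists2 u, e v u & f v = (f u).+1) is left ex
  then sval (cid2 ex) else v.
have parentP v : (0 < f v)%N -> e v (parent v) /\ f v = (f (parent v)).+1.
  by move=> /fS ex; rewrite /parent; case: pselect => // {}ex; case: cid2.
pose bad v := if (0 < f v)%N then \bigcap_(t in [set` iota ((f v).-1 * N) N])
  [set w | m w t v <> Some (parent v)] else set0.
have mbad v : measurable (bad v).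
  rewrite /bad; case: ifP => // _; apply: fin_bigcap_measurable => // t _.
  by apply: measurableC; exact: measurable_pull_moves.
have mU : measurable (\big[setU/set0]_(v <- enum V) bad v).
  exact: bigsetU_measurable.
have sub : [set w | ~~ all_gnostic (m w) s0 (M * N)] `<=`
    \big[setU/set0]_(v <- enum V) bad v.
  move=> w /=; apply: contraPP => nbad; apply/negP; rewrite negbK.
  apply/forallP => v.
  apply: (@isSome_pull_state_mono _ _ _ _ (f v * N)); first by rewrite leq_mul2r fM orbT.
  apply: (isSome_pull_state_phase f0 (parent := parent)) => [x x0|{}v v0].
    by case: (parentP x x0).
  apply: contrapT => nt; apply: nbad; rewrite -bigcup_seq.
  exists v; rewrite /= ?mem_enum // /bad v0 => t /=; rewrite mem_iota => tN mt.
  by apply: nt; exists t.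
have mN := measurable_not_all_gnostic (M * N).
apply: (le_trans (le_measure P _ _ sub)); rewrite ?inE //.
apply: (le_trans (measure_bigU_le _ mbad)).
rewrite mulr_natl -sumr_const -sumEFin big_enum /=; apply: lee_sum => v _.
rewrite /bad; case: ifPn => [v0|_]; last first.
  by rewrite measure0 lee_fin exprn_ge0 // miss_prob_ge0.
by rewrite probability_miss ?outk //; case: (parentP v v0).
Qed.

End Moves.

(** * The tail and expectation bounds *)

Theorem corollary1 (R : realType) (d : measure_display)
    (Omega : measurableType d) (P : probability Omega R)
    (n : nat) (V : finType) (e : rel V) (K : Type)
    (sched : schedule) (m : Omega -> nat -> V -> option V)
    (s0 : V -> option K)
    (hn : #|V| = n)
    (hconn : strongly_connected e)
    (hreg : regular e)
    (hm : pull_moves sched P e m)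
    (hD0 : gnostic s0 != finset.set0) :
  let Ta : Omega -> \bar R := fun w => gnostic_time R (m w) s0 in
  let g : nat -> R := time_scale R sched in
  (forall C : nat -> R,
     (P [set w | ((C n * n%:R * g n)%:E < Ta w)%E] <=
      (2 * n%:R `^ (- (C n / 3) + 2))%:E)%E) /\
  (\int[P]_w Ta w <= (6 * n%:R * g n + 4)%:E)%E.
Proof.
move=> Ta g; subst n; set n := #|V|.
have [k degk] := hreg.
have outk v : #|out_nbrs e v| = k by case: (degk v).
have outsum v : (\sum_u e v u = k)%N.
  rewrite -(outk v) -sum1_card [RHS]big_mkcond; apply: eq_bigr => u _.
  by rewrite inE; case: (e _ _).
have insum u : (\sum_v e v u = k)%N.
  have [_ <-] := degk u.
  by rewrite -sum1_card [RHS]big_mkcond; apply: eq_bigr => v _; rewrite inE; case: (e _ _).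
have [f [f0 fstep fdown]] := level_exists hconn hD0.
have f0s v : f v = 0%N -> isSome (s0 v) by move/eqP; rewrite f0 inE.
pose M := (\max_v f v)%N.
have fM v : (f v <= M)%N by exact: leq_bigmax.
have n0 : (0 < n)%N.
  by have /finset.set0Pn[v _] := hD0; apply/card_gt0P; exists v.
have [vM fvM] : exists v, f v = M by have [v Mv] := bigop.eq_bigmax f n0; exists v.
have layers i : (i <= M)%N -> exists v, f v = i.
  by rewrite -fvM; exact: level_downward fdown vM i.
have Mn : (M < n)%N := layer_count_le_order layers.
have Mk : (M.+1 * k <= 3 * n)%N :=
  layer_count_degree outsum insum fstep layers.
have g0 : 0 <= n%:R * g n.
  have ln0 : 0 <= ln (n%:R : R) by rewrite ln_ge0 // ler1n.
  by rewrite /g; case: (sched) => /=; rewrite !mulr_ge0.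
pose a t : \bar R := P [set w | ~~ all_gnostic (m w) s0 t].
(* [t %/ M] is the largest block length for which [M] blocks fit into [t] rounds; the remaining
   rounds cannot undo gnosticism. *)
have aphase t : (0 < M)%N -> (a t <=
    (n%:R * (1 - (selection_period sched n k)%:R^-1) ^+ (t %/ M))%:E)%E.
  move=> M0; apply: le_trans (probability_not_all_gnostic hm _ outk f0s fdown fM).
  apply: le_measure; rewrite ?inE; try exact: (measurable_not_all_gnostic hm).
  move=> w /=; apply: contra; apply: all_gnostic_mono.
  by rewrite mulnC leq_trunc_div.
(* If [M = 0], every vertex is gnostic at the start. This case is kept apart because it has no
   blocks and [k] may be 0. *)
have a_M0 t : M = 0%N -> a t = 0%E.
  move=> M0; rewrite /a (_ : [set w | _] = set0) ?measure0 //.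
  rewrite -subset0 => w /= /negP; apply; apply/forallP => v.
  apply: (isSome_pull_state_mono (leq0n t)); apply: f0s.
  by apply/eqP; rewrite -leqn0 -M0.
have k0 : (0 < M)%N -> (0 < k)%N.
  rewrite -fvM => /fdown[u vu _].
  by rewrite -(outsum vM) (bigD1 u) //= vu.
have q0 : (0 < M)%N -> (0 < selection_period sched n k)%N.
  by move=> /k0 k1; case: (sched) => //=; rewrite muln_gt0 n0.
split=> [C|].
  have n1R : 1 <= n%:R :> R by rewrite ler1n.
  (* For negative [C n] the exponent is positive, so the right side is at least 2. *)
  case: (lerP 0 (C n)) => C0; last first.
    apply: (le_trans (probability_le1 _ _)).
      exact: (measurable_gnostic_time_gt hm).
    rewrite lee_fin.
    have : n%:R `^ 0 <= n%:R `^ (- (C n / 3) + 2) :> R.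
      by rewrite ler_powR //; lra.
    by rewrite powRr0; lra.
  have c0 : 0 <= C n * (n%:R * g n) by rewrite mulr_ge0.
  rewrite -mulrA; under eq_set do rewrite /Ta gnostic_time_gt //.
  rewrite -/(a _); case: (posnP M) => M0.
    by rewrite a_M0 // lee_fin mulr_ge0 // powR_ge0.
  apply: (le_trans (aphase _ M0)); rewrite lee_fin.
  apply: miss_prob_tail => //; [exact: leq_trans Mn|exact: q0|].
  exact: selection_period_ln.
rewrite /Ta (expectation_gnostic_time hm) -mulrA.
case: (posnP M) => M0.
  rewrite eseries0; last by move=> t _ _; exact: a_M0.
  by rewrite lee_fin; lra.
set q := selection_period sched n k in aphase q0.
have q1 := q0 M0.
have afin t : a t \is a fin_num.
  by apply: fin_num_measure; exact: (measurable_not_all_gnostic hm).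
have ln0 : 0 <= ln (n%:R : R) by rewrite ln_ge0 // ler1n.
(* The first integer above [q ln n]: from there on [n (1 - 1/q)^N <= n exp(-N/q) <= 1], so the union
   bound beats the trivial one. *)
pose N := (Num.truncn (q%:R * ln (n%:R : R))).+1.
have /andP[Nle /ltW leN] := truncn_itv (mulr_ge0 (ler0n R q) ln0).
have nN : n%:R * (1 - q%:R^-1) ^+ N <= 1 :> R.
  have n0R : 0 < n%:R :> R by rewrite ltr0n.
  rewrite mulrC -ler_pdivlMr // div1r.
  apply: (le_trans (miss_prob_expr_le _ _ _)).
  rewrite -[leRHS]lnK ?posrE ?invr_gt0 // ler_expR lnV ?posrE // lerN2.
  by rewrite ler_pdivlMr ?ltr0n // mulrC.
(* It suffices to bound every partial sum uniformly in its length [T]. *)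
apply: lime_le; first by apply: is_cvg_nneseries => t _ _; exact: measure_ge0.
apply: nearW => T.
rewrite (eq_bigr (fun t => (fine (a t))%:E)) => [|t _]; last by rewrite fineK.
rewrite sumEFin lee_fin.
pose b j : R := Num.min 1 (n%:R * (1 - q%:R^-1) ^+ j).
apply: (le_trans (sum_block_le (b := b) T M0 _ _)).
- by move=> t; rewrite fine_ge0 // measure_ge0.
- move=> t; rewrite le_min -!lee_fin fineK // aphase // andbT.
  by apply: probability_le1; exact: (measurable_not_all_gnostic hm).
apply: (@le_trans _ _ (M%:R * (N%:R + q%:R))).
  by rewrite ler_wpM2l // sum_min_geometric_le.
have n1 : (1 < n)%N by exact: leq_trans Mn.
(* [M (N + q)] is at most [M q ln n] plus [M + M q]: the first is at most 3 n g(n), the second at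
   most 3 n g(n) + 4. *)
have := selection_period_ln R sched Mk.
have := selection_period_overhead R sched n1 (k0 M0) Mn Mk.
rewrite -/q -/g natrM.
have : M%:R * N%:R <= M%:R * (q%:R * ln n%:R + 1) :> R.
  by rewrite ler_wpM2l // -natr1 lerD2r.
lra.
Qed.
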